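(* Let $\mathbb{F}$ be an infinite field of arbitrary characteristic, let $\mathsf{A}_1$ be the Weyl algebra over $\mathbb{F}$ with generators $x,y$, and let $\mathsf{V}=\mathbb{F}\text{-}\mathrm{span}\{x,y\}\subset\mathsf{A}_1$. 1. The minimal degree of a non-trivial (i.e. nonzero) weak polynomial identity for the pair $(\mathsf{A}_1,\mathsf{V})$ is three. 2. For $|\Delta|=3$, the vector space $\mathrm{Id}(\mathsf{A}_1,\mathsf{V})_{\Delta}$ has the following basis: (i) $\Gamma_3(x_1,x_2,x_3)$, $\Gamma_3(x_1,x_3,x_2)$ and $\mathrm{St}_3(x_1,x_2,x_3)$, in case $\Delta=(1,1,1)$; (ii) $\Gamma_3(x_1,x_2,x_1)$, in case $\Delta=(2,1)$; (iii) $\emptyset$, in case $\Delta=(3)$.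
   Context: The Weyl algebra is the unital associative algebra $\mathsf{A}_1=\mathbb{F}\langle x,y\rangle/(yx-xy-1)$. $\mathbb{F}\langle X\rangle$ is the free unital associative $\mathbb{F}$-algebra on free generators $x_1,x_2,\ldots$. A weak polynomial identity for the pair $(\mathsf{A}_1,\mathsf{V})$ is an element $f(x_1,\ldots,x_m)\in\mathbb{F}\langle X\rangle$ such that $f(v_1,\ldots,v_m)=0$ in $\mathsf{A}_1$ for all $v_1,\ldots,v_m\in\mathsf{V}$. The set of all of them is the ideal $\mathrm{Id}(\mathsf{A}_1,\mathsf{V})$ of $\mathbb{F}\langle X\rangle$. For $\Delta=(\delta_1,\ldots,\delta_m)\in\mathbb{N}_0^m$ put $|\Delta|=\delta_1+\cdots+\delta_m$; an element of $\mathbb{F}\langle X\rangle$ has multidegree $\Delta$ if it is a linear combination of monomials in $x_1,\ldots,x_m$ in which each $x_i$ occurs exactly $\delta_i$ times. $\mathrm{Id}(\mathsf{A}_1,\mathsf{V})_{\Delta}$ denotes the vector space of all elements of $\mathrm{Id}(\mathsf{A}_1,\mathsf{V})$ of multidegree $\Delta$ (including $0$). Here $[a,b]=ab-ba$, and $$\Gamma_3(x_1,x_2,x_3)=[[x_1,x_2],x_3],\qquad \mathrm{St}_3(x_1,x_2,x_3)=x_1[x_2,x_3]-x_2[x_1,x_3]+x_3[x_1,x_2].$$ *)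

(* Defs.v *)
From HB Require Import structures.
From mathcomp Require Import all_boot all_order all_algebra finmap.
From mathcomp Require Import generic_quotient ring_quotient.
From mathcomp Require Import boolp classical_sets cardinality.
From mathcomp.multinomials Require Import monalg.

Set Implicit Arguments.
Unset Strict Implicit.
Unset Printing Implicit Defensive.

Import GRing.Theory.
Local Open Scope ring_scope.
Local Open Scope quotient_scope.

(* The free unital associative algebra R<X_i : i in I>, realized as the algebra
   of the free monoid of words over I. *)
Notation freeAlg R I := {malg R[{fmonom I}]}.

Definition fgen (R : nzRingType) (I : choiceType) (i : I) : freeAlg R I :=
  << fmu i >>.

Section MalgScale.
Context (K : monomType) (R : comNzRingType).

Lemma malg_scalerAr (c : R) (g h : {malg R[K]}) : c *: (g * h) = g * (c *: h).
Proof.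
apply/malgP => k; rewrite mcoeffZ.
rewrite (mcoeffMlw k (fsubset_refl (msupp g)) (fsubset_refl (msupp h))).
rewrite (mcoeffMlw k (fsubset_refl (msupp g)) (msuppZ_le c h)).
rewrite mulr_sumr; apply: eq_bigr => k1 _; rewrite mulr_sumr.
by apply: eq_bigr => k2 _; rewrite mcoeffZ mulrnAr mulrCA.
Qed.

End MalgScale.

Section WeylAlgebra.
Context (F : fieldType).

Local Notation W := (freeAlg F bool).
Local Notation x := (fgen F false).
Local Notation y := (fgen F true).

Definition weyl_rel : W := y * x - x * y - 1.

Definition weyl_ideal : {pred W} := fun f =>
  `[< exists s : seq (W * W), f = \sum_(p <- s) p.1 * weyl_rel * p.2 >].

Lemma weyl_idealP (f : W) :
  reflect (exists s : seq (W * W), f = \sum_(p <- s) p.1 * weyl_rel * p.2)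
          (f \in weyl_ideal).
Proof. exact: asboolP. Qed.

Lemma weyl_ideal_zmod : zmod_closed weyl_ideal.
Proof.
split; first by apply/weyl_idealP; exists [::]; rewrite big_nil.
move=> f g /weyl_idealP[s ->] /weyl_idealP[t ->]; apply/weyl_idealP.
exists (s ++ [seq (- p.1, p.2) | p <- t]); rewrite big_cat big_map /= -sumrN.
by congr (_ + _); apply: eq_bigr => p _; rewrite !mulNr.
Qed.

HB.instance Definition _ := GRing.isZmodClosed.Build W weyl_ideal
  weyl_ideal_zmod.

Lemma weyl_idealMl (a f : W) : f \in weyl_ideal -> a * f \in weyl_ideal.
Proof.
move=> /weyl_idealP[s ->]; apply/weyl_idealP.
exists [seq (a * p.1, p.2) | p <- s]; rewrite big_map mulr_sumr.
by apply: eq_bigr => p _ /=; rewrite !mulrA.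
Qed.

Lemma weyl_idealMr (a f : W) : f \in weyl_ideal -> f * a \in weyl_ideal.
Proof.
move=> /weyl_idealP[s ->]; apply/weyl_idealP.
exists [seq (p.1, p.2 * a) | p <- s]; rewrite big_map mulr_suml.
by apply: eq_bigr => p _ /=; rewrite !mulrA.
Qed.

(* That the ideal is proper is seen on the action on F[t] with x acting as
   multiplication by t and y as d/dt (not faithful in positive characteristic,
   but 1 does not act as 0). *)
Definition word_act (w : {fmonom bool}) (p : {poly F}) : {poly F} :=
  foldr (fun b q => if b then q^`() else 'X * q) p (w : seq bool).

Definition weyl_act (p : {poly F}) (f : W) : {poly F} :=
  mmap polyC (fun w => word_act w p) f.

Lemma word_act_linear (w : {fmonom bool}) : linear (word_act w).
Proof.
move=> c p q; rewrite /word_act; elim: (w : seq bool) => //= b s ->.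
by case: b; rewrite ?derivD ?derivZ // mulrDr scalerAr.
Qed.

HB.instance Definition _ w :=
  GRing.isLinear.Build F {poly F} {poly F} *:%R (word_act w)
    (word_act_linear w).

Lemma word_actM (v w : {fmonom bool}) (p : {poly F}) :
  word_act (mmul v w) p = word_act v (word_act w p).
Proof. by rewrite /word_act fmM foldr_cat. Qed.

Lemma weyl_actM (p : {poly F}) (f g : W) :
  weyl_act p (f * g) = weyl_act (weyl_act p g) f.
Proof.
rewrite /weyl_act malgME raddf_sum [RHS]mmapE; apply: eq_bigr => v _.
rewrite raddf_sum [in RHS]mmapE linear_sum mulr_sumr; apply: eq_bigr => w _.
by rewrite /= mmapU word_actM !mul_polyC linearZ /= scalerA.
Qed.

Lemma weyl_act_gen p (b : bool) :
  weyl_act p (fgen F b) = if b then p^`() else 'X * p.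
Proof. by rewrite /weyl_act mmapU /= polyC1 mul1r /word_act fmU /=; case: b. Qed.

Lemma weyl_act1 p : weyl_act p 1 = p.
Proof. by rewrite /weyl_act mmapU /= polyC1 mul1r /word_act fm1. Qed.

Lemma weyl_act_rel p : weyl_act p weyl_rel = 0.
Proof.
rewrite /weyl_rel /weyl_act !raddfB /= -!/(weyl_act _ _) !weyl_actM.
by rewrite weyl_act1 !weyl_act_gen derivM derivX mul1r addrK subrr.
Qed.

Lemma weyl_act0 (f : W) : weyl_act 0 f = 0.
Proof. by rewrite /weyl_act mmapE big1 // => w _; rewrite raddf0 mulr0. Qed.

Lemma weyl_ideal1 : 1 \notin weyl_ideal.
Proof.
apply/negP => /weyl_idealP[s]; move/(congr1 (weyl_act 1)).
rewrite weyl_act1 /weyl_act raddf_sum /= big1 => [/eqP|p _].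
  by rewrite oner_eq0.
by rewrite -/(weyl_act _ _) !weyl_actM weyl_act_rel weyl_act0.
Qed.

Definition weyl : Type := Quotient.quot weyl_ideal.

HB.instance Definition _ := GRing.Zmodule.on weyl.

Definition weyl_pi (f : W) : weyl := \pi_(Quotient.quot weyl_ideal) f.

Lemma weyl_piP (f g : W) : weyl_pi f = weyl_pi g <-> f - g \in weyl_ideal.
Proof. by split=> [/eqP|H]; [|apply/eqP]; rewrite -Quotient.idealrBE. Qed.

Definition weyl_repr (a : weyl) : W := repr (a : Quotient.quot weyl_ideal).

Lemma weyl_reprK : cancel weyl_repr weyl_pi.
Proof. by move=> a; rewrite /weyl_pi /weyl_repr reprK. Qed.

Lemma weyl_piK (f : W) : weyl_repr (weyl_pi f) - f \in weyl_ideal.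
Proof. by apply/weyl_piP; rewrite weyl_reprK. Qed.

Lemma weyl_piB : {morph weyl_pi : f g / f - g}.
Proof.
by move=> f g; rewrite /weyl_pi Quotient.pi_add Quotient.pi_opp.
Qed.

HB.instance Definition _ := GRing.isZmodMorphism.Build W weyl weyl_pi weyl_piB.

Definition weyl_one : weyl := weyl_pi 1.
Definition weyl_mul (a b : weyl) : weyl :=
  weyl_pi (weyl_repr a * weyl_repr b).
Definition weyl_scale (c : F) (a : weyl) : weyl := weyl_pi (c *: weyl_repr a).

Lemma weyl_mulE (f g : W) : weyl_mul (weyl_pi f) (weyl_pi g) = weyl_pi (f * g).
Proof.
apply/weyl_piP; rewrite -(subrKA (f * weyl_repr (weyl_pi g))) -mulrBl -mulrBr.
by apply: rpredD; [apply: weyl_idealMr | apply: weyl_idealMl]; exact: weyl_piK.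
Qed.

Lemma weyl_scaleE c (f : W) : weyl_scale c (weyl_pi f) = weyl_pi (c *: f).
Proof.
by apply/weyl_piP; rewrite -scalerBr -mul_malgC weyl_idealMl // weyl_piK.
Qed.

Lemma weyl_ind (P : weyl -> Prop) : (forall f, P (weyl_pi f)) -> forall a, P a.
Proof. by move=> H a; rewrite -[a]weyl_reprK. Qed.

Lemma weyl_mulA : associative weyl_mul.
Proof.
by elim/weyl_ind=> f; elim/weyl_ind=> g; elim/weyl_ind=> h; rewrite !weyl_mulE mulrA.
Qed.

Lemma weyl_mul1 : left_id weyl_one weyl_mul.
Proof. by elim/weyl_ind=> f; rewrite weyl_mulE mul1r. Qed.

Lemma weyl_1mul : right_id weyl_one weyl_mul.
Proof. by elim/weyl_ind=> f; rewrite weyl_mulE mulr1. Qed.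

Lemma weyl_mulDl : left_distributive weyl_mul +%R.
Proof.
elim/weyl_ind=> f; elim/weyl_ind=> g; elim/weyl_ind=> h.
by rewrite -raddfD !weyl_mulE mulrDl raddfD.
Qed.

Lemma weyl_mulDr : right_distributive weyl_mul +%R.
Proof.
elim/weyl_ind=> f; elim/weyl_ind=> g; elim/weyl_ind=> h.
by rewrite -raddfD !weyl_mulE mulrDr raddfD.
Qed.

Lemma weyl_one_neq0 : weyl_one != 0.
Proof.
apply/eqP; rewrite -(raddf0 weyl_pi) => /weyl_piP.
by rewrite subr0 (negPf weyl_ideal1).
Qed.

HB.instance Definition _ := GRing.Zmodule_isNzRing.Build weyl
  weyl_mulA weyl_mul1 weyl_1mul weyl_mulDl weyl_mulDr weyl_one_neq0.

Lemma weyl_scaleA c d a : weyl_scale c (weyl_scale d a) = weyl_scale (c * d) a.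
Proof. by elim/weyl_ind: a => f; rewrite !weyl_scaleE scalerA. Qed.

Lemma weyl_scale1 : left_id 1 weyl_scale.
Proof. by elim/weyl_ind=> f; rewrite weyl_scaleE scale1r. Qed.

Lemma weyl_scaleDr : right_distributive weyl_scale +%R.
Proof.
move=> c; elim/weyl_ind=> f; elim/weyl_ind=> g.
by rewrite -raddfD !weyl_scaleE scalerDr raddfD.
Qed.

Lemma weyl_scaleDl a : {morph weyl_scale^~ a : c d / c + d}.
Proof.
by elim/weyl_ind: a => f c d; rewrite !weyl_scaleE scalerDl raddfD.
Qed.

HB.instance Definition _ := GRing.Zmodule_isLmodule.Build F weyl
  weyl_scaleA weyl_scale1 weyl_scaleDr weyl_scaleDl.

Lemma weyl_scalerAl (c : F) (a b : weyl) : c *: (a * b) = (c *: a) * b.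
Proof.
elim/weyl_ind: a => f; elim/weyl_ind: b => g; rewrite /GRing.scale /GRing.mul /=.
by rewrite weyl_mulE !weyl_scaleE weyl_mulE -scalerAl.
Qed.

Lemma weyl_scalerAr (c : F) (a b : weyl) : c *: (a * b) = a * (c *: b).
Proof.
elim/weyl_ind: a => f; elim/weyl_ind: b => g; rewrite /GRing.scale /GRing.mul /=.
by rewrite weyl_mulE !weyl_scaleE weyl_mulE malg_scalerAr.
Qed.

HB.instance Definition _ := GRing.Lmodule_isLalgebra.Build F weyl weyl_scalerAl.
HB.instance Definition _ := GRing.Lalgebra_isAlgebra.Build F weyl weyl_scalerAr.

Definition weyl_x : weyl := weyl_pi x.
Definition weyl_y : weyl := weyl_pi y.

Lemma weyl_relE : weyl_y * weyl_x - weyl_x * weyl_y = 1.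
Proof.
rewrite /GRing.mul /= !weyl_mulE -raddfB; apply/weyl_piP/weyl_idealP.
by exists [:: (1, 1)]; rewrite big_seq1 mul1r mulr1.
Qed.

Definition weylV : set weyl :=
  [set v | exists a b : F, v = a *: weyl_x + b *: weyl_y]%classic.

End WeylAlgebra.

Arguments weyl_x {F}.
Arguments weyl_y {F}.

Section WeakIdentities.
Context (F : fieldType).

(* Numbered from 0: the free generators x_1, x_2, .. are xgen F 0, xgen F 1, .. *)
Definition xgen (i : nat) : freeAlg F nat := fgen F i.

(* The value f(v 0, v 1, ..): only finitely many v i occur. *)
Definition feval (A : algType F) (v : nat -> A) (f : freeAlg F nat) : A :=
  mmap (in_alg A) (fun w : {fmonom nat} => \prod_(i <- (w : seq nat)) v i) f.

Definition weakId : set (freeAlg F nat) :=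
  [set f | forall v : nat -> weyl F, (forall i, weylV (v i)) ->
     feval v f = 0]%classic.

(* Total degree; it is 0 for f = 0. *)
Definition fdegree (f : freeAlg F nat) : nat :=
  \max_(w <- msupp f) size (w : seq nat).

(* Generators x_i with i beyond the length of D do not occur. *)
Definition multideg (D : seq nat) (f : freeAlg F nat) : Prop :=
  forall w : {fmonom nat}, w \in msupp f ->
    forall i : nat, count_mem i (w : seq nat) = nth 0%N D i.

Definition weakId_multideg (D : seq nat) : set (freeAlg F nat) :=
  [set f | weakId f /\ multideg D f]%classic.

Definition is_basis (V : lmodType F) (S : set V) (b : seq V) : Prop :=
  (forall c : 'I_(size b) -> F,
     \sum_(i < size b) c i *: b`_i = 0 -> forall i, c i = 0) /\
  (forall u : V,
     S u <-> exists c : 'I_(size b) -> F, u = \sum_(i < size b) c i *: b`_i).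

End WeakIdentities.

Definition lie_bracket (R : nzRingType) (a b : R) : R := a * b - b * a.

Definition Gamma3 (R : nzRingType) (a b c : R) : R := lie_bracket (lie_bracket a b) c.

Definition St3 (R : nzRingType) (a b c : R) : R :=
  a * lie_bracket b c - b * lie_bracket a c + c * lie_bracket a b.

(* Main.v *)
From HB Require Import structures.
Require Import Defs.
From mathcomp Require Import all_boot all_order all_algebra finmap.
From mathcomp Require Import ring zify.
From mathcomp Require Import boolp classical_sets cardinality.
From mathcomp.multinomials Require Import monalg.

(** Two facts about the Weyl algebra carry the whole proof: the commutation
    rule [y x = x y + 1], and the independence of the normal monomials [x^n]
    and [x^n y] ([weyl_free]), i.e. [p(x) + q(x) y = 0] forces [p = q = 0].
    The latter is read off the action on [F[t]] in which [x] multiplies by [t]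
    and [y] is [d/dt]: applied to [1] the operator [p(x) + q(x) y] gives [p],
    and applied to [t] it then gives [q].  In characteristic [p > 0] the action is
    not faithful, but only from [y^p] on, and monomials with at most one [y]
    suffice below.

    The three polynomials are weak identities because the span of [x] and [y]
    is two-dimensional and any two of its elements have a scalar commutator
    ([span_bracket]).  So [Gamma3] vanishes, being a commutator with a scalar;
    and [St3], being alternating and trilinear on a plane, vanishes as well.

    Conversely, let [f] be a weak identity.
    - If all words of [f] have length at most two, substituting [x] for one
      letter and [0] for the others kills the coefficients of the words in that
      letter, and substituting [y] and [x] for two letters kills those of the
      mixed words ([low_degree_vanishing]).  So the minimal degree is three.
    - In multidegree (1,1,1), substituting [y] for one of the three letters and
      [x] for the other two yields, after normal ordering, a multiple of
      [x^2 y] plus a multiple of [x]: two linear relations among the six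
      coefficients ([multilinear_relations]).  For the first two letters these
      are three independent relations in every characteristic, so that at most
      three coefficients remain free; the two commutators and the standard
      polynomial realise every choice of these.
    - In multidegrees (2,1) and (3) the same substitutions leave one free
      coefficient and none.

    The linear systems are solved without division, hence in the same way in
    every characteristic.  Everything up to the Weyl algebra itself is stated
    for an arbitrary algebra with elements [x], [y] that have the two
    properties. *)

Set Implicit Arguments.
Unset Strict Implicit.
Unset Printing Implicit Defensive.

Import GRing.Theory.
Local Open Scope ring_scope.

(** * Words, coefficients and evaluation in the free algebra *)

Lemma prod0 (R : pzRingType) (I : eqType) (s : seq I) (v : I -> R) i :
  i \in s -> v i = 0 -> \prod_(j <- s) v j = 0.
Proof.
move=> + vi; elim: s => // j s IHs; rewrite inE big_cons.
by case: eqP => [<-|_ /IHs->]; rewrite ?vi ?mul0r ?mulr0.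
Qed.

(** Locked, so that distinct words are told apart by their letters, without
    unfolding the monoid algebra. *)
HB.lock Definition word (F : fieldType) (s : seq nat) : freeAlg F nat :=
  << FMonom s >>.

Lemma lie_bracketC (R : nzRingType) (a b : R) :
  lie_bracket a b = - lie_bracket b a.
Proof. by rewrite /lie_bracket opprB. Qed.

Lemma lie_bracketBl (R : nzRingType) (a b c : R) :
  lie_bracket (a - b) c = lie_bracket a c - lie_bracket b c.
Proof.
rewrite /lie_bracket mulrBl mulrBr !opprB addrACA [RHS]addrACA.
by congr (_ + _); rewrite addrC.
Qed.

Section FreeAlgebra.
Context (F : fieldType).
Local Notation word := (word F).
Implicit Types (f g h : freeAlg F nat) (s t w : seq nat).

Definition wcoef f w : F := f@_(FMonom w).

Lemma wcoef_inj f g : wcoef f =1 wcoef g -> f = g.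
Proof. by move=> fg; apply/malgP => k; have := fg k; rewrite /wcoef fmK. Qed.

Lemma wcoef0 w : wcoef 0 w = 0. Proof. exact: mcoeff0. Qed.
Lemma wcoefD f g w : wcoef (f + g) w = wcoef f w + wcoef g w.
Proof. exact: mcoeffD. Qed.
Lemma wcoefB f g w : wcoef (f - g) w = wcoef f w - wcoef g w.
Proof. exact: mcoeffB. Qed.
Lemma wcoefZ c f w : wcoef (c *: f) w = c * wcoef f w.
Proof. exact: mcoeffZ. Qed.
Lemma wcoef_word s w : wcoef (word s) w = (s == w)%:R.
Proof. by rewrite word.unlock /wcoef mcoeffU1 fmP. Qed.

Lemma xgen_word i : xgen F i = word [:: i].
Proof. by rewrite word.unlock -fmuE. Qed.

Lemma wordM s t : word s * word t = word (s ++ t).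
Proof.
rewrite word.unlock malgM_def fgmulUU mulr1; congr (<< _ >>).
by apply/eqP; rewrite fmP fmM.
Qed.

Lemma lie_bracket_word s t :
  lie_bracket (word s) (word t) = word (s ++ t) - word (t ++ s).
Proof. by rewrite /lie_bracket (wordM s t) (wordM t s). Qed.

Lemma Gamma3_word i j k : Gamma3 (xgen F i) (xgen F j) (xgen F k) =
  word [:: i; j; k] - word [:: k; i; j] -
    (word [:: j; i; k] - word [:: k; j; i]).
Proof.
rewrite /Gamma3 3!xgen_word lie_bracket_word lie_bracketBl.
by congr (_ - _); apply: lie_bracket_word.
Qed.

Lemma St3_word i j k : St3 (xgen F i) (xgen F j) (xgen F k) =
  word [:: i; j; k] - word [:: i; k; j] -
    (word [:: j; i; k] - word [:: j; k; i]) +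
    (word [:: k; i; j] - word [:: k; j; i]).
Proof.
have mul_bracket s t u : word s * lie_bracket (word t) (word u) =
    word (s ++ (t ++ u)) - word (s ++ (u ++ t)).
  by rewrite lie_bracket_word mulrBr; congr (_ - _); apply: wordM.
have sub_add (a b c a' b' c' : freeAlg F nat) :
    a = a' -> b = b' -> c = c' -> a - b + c = a' - b' + c' by move=> -> -> ->.
by rewrite 3!xgen_word; apply: sub_add; apply: mul_bracket.
Qed.

Lemma wcoef_Gamma3 i j k w : wcoef (Gamma3 (xgen F i) (xgen F j) (xgen F k)) w =
  ([:: i; j; k] == w)%:R - ([:: k; i; j] == w)%:R -
  (([:: j; i; k] == w)%:R - ([:: k; j; i] == w)%:R).
Proof.
have wcoef4 (a b c d : freeAlg F nat) : wcoef (a - b - (c - d)) w =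
  wcoef a w - wcoef b w - (wcoef c w - wcoef d w) by rewrite 3!wcoefB.
by rewrite Gamma3_word wcoef4 4!wcoef_word.
Qed.

Lemma wcoef_St3 i j k w : wcoef (St3 (xgen F i) (xgen F j) (xgen F k)) w =
  ([:: i; j; k] == w)%:R - ([:: i; k; j] == w)%:R -
  (([:: j; i; k] == w)%:R - ([:: j; k; i] == w)%:R) +
  (([:: k; i; j] == w)%:R - ([:: k; j; i] == w)%:R).
Proof.
have wcoef6 (a b c d e f : freeAlg F nat) :
    wcoef (a - b - (c - d) + (e - f)) w =
    wcoef a w - wcoef b w - (wcoef c w - wcoef d w) + (wcoef e w - wcoef f w).
  by rewrite wcoefD 4!wcoefB.
by rewrite St3_word wcoef6 6!wcoef_word.
Qed.

Section Evaluation.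
Context (A : algType F) (v : nat -> A).

Lemma fevalD f g : feval v (f + g) = feval v f + feval v g.
Proof. exact: mmapD. Qed.

Lemma fevalB f g : feval v (f - g) = feval v f - feval v g.
Proof. exact: mmapB. Qed.

Lemma fevalZ c f : feval v (c *: f) = c *: feval v f.
Proof.
rewrite /feval (mmapEw (msuppZ_le _ _)) mmapE scaler_sumr /=.
by apply: eq_bigr => k _; rewrite mcoeffZ !mulr_algl scalerA.
Qed.

Lemma feval_gen i : feval v (xgen F i) = v i.
Proof. by rewrite /feval mmapU /= fmuE big_seq1 scale1r mul1r. Qed.

Lemma fevalM f g : feval v (f * g) = feval v f * feval v g.
Proof.
rewrite /feval malgME raddf_sum [in RHS]mmapE mulr_suml; apply: eq_bigr => k _.
rewrite raddf_sum [in RHS]mmapE mulr_sumr; apply: eq_bigr => l _ /=.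
by rewrite mmapU /= fmM big_cat /= !mulr_algl -scalerAl -scalerAr scalerA.
Qed.

Lemma feval_lie_bracket f g :
  feval v (lie_bracket f g) = lie_bracket (feval v f) (feval v g).
Proof. by rewrite /lie_bracket fevalB; congr (_ - _); apply: fevalM. Qed.

Lemma feval_Gamma3 f g h :
  feval v (Gamma3 f g h) = Gamma3 (feval v f) (feval v g) (feval v h).
Proof. by rewrite /Gamma3 2!feval_lie_bracket. Qed.

Lemma feval_St3 f g h :
  feval v (St3 f g h) = St3 (feval v f) (feval v g) (feval v h).
Proof.
have feval3 p q r : feval v (p - q + r) = feval v p - feval v q + feval v r.
  by rewrite fevalD fevalB.
have fevalB3 p q r :
    feval v (p * lie_bracket q r) = feval v p * lie_bracket (feval v q) (feval v r).
  by rewrite fevalM feval_lie_bracket.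
by rewrite /St3 feval3; congr (_ - _ + _); apply: fevalB3.
Qed.

(** An evaluation may be computed on any finite list of words, as long as the
    words of [f] that are left out evaluate to zero; substituting zero for some
    generators thus discards all words that contain them. *)
Lemma feval_supp (L : seq (seq nat)) f : uniq L ->
  (forall w, w \notin L -> wcoef f w != 0 -> \prod_(i <- w) v i = 0) ->
  feval v f = \sum_(w <- L) wcoef f w *: \prod_(i <- w) v i.
Proof.
move=> uL f0; pose M := [seq FMonom w | w <- L].
have uM : uniq M by rewrite map_inj_uniq // => a b [].
rewrite /feval (mmapEw (d := (msupp f `|` [fset k in M])%fset)) ?fsubsetUl //.
rewrite (bigID (fun k => k \in M)) /= [X in _ + X]big1 => [|k kM]; last first.
  rewrite mulr_algl; have [->|fk] := eqVneq f@_k 0; first by rewrite scale0r.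
  rewrite f0 ?scaler0 // /wcoef ?fmK //; apply: contra kM => kL.
  by rewrite -[k]fmK map_f.
rewrite addr0 -big_filter (perm_big M); last first.
  apply: uniq_perm; rewrite ?filter_uniq ?fset_uniq // => k.
  by rewrite mem_filter in_fsetU !inE /=; case: (k \in M); rewrite ?orbT.
by rewrite big_map; apply: eq_bigr => w _; rewrite mulr_algl.
Qed.

End Evaluation.
End FreeAlgebra.

(** * Multidegrees *)

Section Multidegree.
Context (F : fieldType).
Implicit Types (f g : freeAlg F nat) (D s w : seq nat) (L : seq (seq nat)).

(** Multidegree as a condition on the coefficients, where the algebra operations
    are easy to follow. *)
Lemma multidegP D f : multideg D f <->
  forall w, wcoef f w != 0 -> forall i, count_mem i w = nth 0%N D i.
Proof.
split=> [Df w|Df w]; first by rewrite /wcoef mcoeff_neq0 => /Df.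
by rewrite -mcoeff_neq0 => fw; apply: (Df w); rewrite /wcoef fmK.
Qed.

Lemma multidegD D f g : multideg D f -> multideg D g -> multideg D (f + g).
Proof.
move=> /multidegP Df /multidegP Dg; apply/multidegP => w.
have [f0|/Df //] := eqVneq (wcoef f w) 0.
by rewrite wcoefD f0 add0r => /Dg.
Qed.

Lemma multidegZ D c f : multideg D f -> multideg D (c *: f).
Proof.
move=> /multidegP Df; apply/multidegP => w.
by rewrite wcoefZ mulf_eq0 negb_or => /andP[_ /Df].
Qed.

Lemma multidegB D f g : multideg D f -> multideg D g -> multideg D (f - g).
Proof. by move=> Df /(@multidegZ D (-1)); rewrite scaleN1r; apply: multidegD. Qed.

Lemma multideg0 D : multideg D (0 : freeAlg F nat).
Proof. by apply/multidegP => w; rewrite wcoef0 eqxx. Qed.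

Lemma multideg_word D s :
  (forall i, count_mem i s = nth 0%N D i) -> multideg D (word F s).
Proof.
move=> Ds; apply/multidegP => w; rewrite wcoef_word.
by have [<-|] := eqVneq s w; rewrite ?eqxx.
Qed.

Section Ternary.
Context (D : seq nat) (i j k : nat).
Context (Dijk : forall l, count_mem l [:: i; j; k] = nth 0%N D l).

Let multideg_ijk s :
  (forall l, count_mem l s = count_mem l [:: i; j; k]) -> multideg D (word F s).
Proof. by move=> sijk; apply: multideg_word => l; rewrite sijk. Qed.

Lemma multideg_Gamma3 : multideg D (Gamma3 (xgen F i) (xgen F j) (xgen F k)).
Proof.
rewrite Gamma3_word; apply: multidegB; apply: multidegB;
  by apply: multideg_ijk => l /=; lia.
Qed.

Lemma multideg_St3 : multideg D (St3 (xgen F i) (xgen F j) (xgen F k)).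
Proof.
rewrite St3_word; apply: multidegD; [apply: multidegB|]; apply: multidegB;
  by apply: multideg_ijk => l /=; lia.
Qed.

End Ternary.

(** A word of multidegree [D] is a rearrangement of any other one, so a single
    sample [s] yields them all. *)
Section Support.
Context (D s : seq nat).
Context (Ds : forall i, count_mem i s = nth 0%N D i).

Lemma multideg_permutations f w :
  multideg D f -> w \notin permutations s -> wcoef f w = 0.
Proof.
move=> /multidegP Df; apply: contraNeq => /Df Dw.
by rewrite mem_permutations /perm_eq; apply/allP => i _; rewrite /= Dw Ds.
Qed.

Lemma multideg_eq f g : multideg D f -> multideg D g ->
  {in permutations s, wcoef f =1 wcoef g} -> f = g.
Proof.
move=> Df Dg fg; apply: wcoef_inj => w.
have [/fg //|ws] := boolP (w \in permutations s).
by rewrite !multideg_permutations.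
Qed.

Lemma feval_multideg (A : algType F) (v : nat -> A) L f :
  perm_eq L (permutations s) -> multideg D f ->
  feval v f = \sum_(w <- L) wcoef f w *: \prod_(i <- w) v i.
Proof.
move=> Ls Df; apply: feval_supp => [|w].
  by rewrite (perm_uniq Ls) permutations_uniq.
by rewrite (perm_mem Ls) => /(multideg_permutations Df)->; rewrite eqxx.
Qed.

Lemma fdegree_multideg f : multideg D f -> f <> 0 -> fdegree f = size s.
Proof.
move=> /multidegP Df f0; apply/eqP; rewrite eqn_leq; apply/andP; split.
  apply/bigmax_leqP_seq => w wf _; rewrite -mcoeff_neq0 in wf.
  rewrite (@perm_size _ w s) // /perm_eq; apply/allP => i _.
  by rewrite /= Ds (Df w) // /wcoef fmK.
have [w fw] : exists w, wcoef f w != 0.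
  apply: contrapT => nf; apply: f0; apply: wcoef_inj => w; rewrite wcoef0.
  by have [//|fw] := eqVneq (wcoef f w) 0; case: nf; exists w.
rewrite -(@perm_size _ w s); last first.
  by rewrite /perm_eq; apply/allP => i _; rewrite /= Ds (Df w).
by apply: (leq_bigmax_seq (FMonom w)); rewrite // -mcoeff_neq0.
Qed.

End Support.

Lemma count_111 l : count_mem l [:: 0; 1; 2]%N = nth 0%N [:: 1; 1; 1]%N l.
Proof. by case: l => [|[|[|l]]] //=; rewrite nth_nil. Qed.

Lemma count_21 l : count_mem l [:: 0; 1; 0]%N = nth 0%N [:: 2; 1]%N l.
Proof. by case: l => [|[|l]] //=; rewrite nth_nil. Qed.

Lemma count_3 l : count_mem l [:: 0; 0; 0]%N = nth 0%N [:: 3]%N l.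
Proof. by case: l => [|l] //=; rewrite nth_nil. Qed.

End Multidegree.

(** * Bases with at most three elements *)

Section SmallBases.
Context (F : fieldType).

Lemma is_basis0 (V : lmodType F) (S : set V) :
  (forall u, S u <-> u = 0) -> is_basis S [::].
Proof.
move=> S0; split=> [c _ []//|u]; rewrite S0; split=> [->|[c]].
  by exists (fun=> 0); rewrite big_ord0.
by rewrite big_ord0.
Qed.

Lemma is_basis1 (V : lmodType F) (S : set V) e : e != 0 ->
  (forall u, S u <-> exists a, u = a *: e) -> is_basis S [:: e].
Proof.
move=> e0 Se; split=> [c|u].
  rewrite big_ord1 /= => /eqP; rewrite scaler_eq0 (negPf e0) orbF => /eqP c0 i.
  by rewrite (ord1 i).
rewrite Se; split=> [[a ->]|[c ->]].
  by exists (fun=> a); rewrite big_ord1.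
by exists (c ord0); rewrite big_ord1.
Qed.

Lemma is_basis3 (V : lmodType F) (S : set V) e1 e2 e3 :
  (forall a b c, a *: e1 + b *: e2 + c *: e3 = 0 -> [/\ a = 0, b = 0 & c = 0]) ->
  (forall u, S u <-> exists a b c, u = a *: e1 + b *: e2 + c *: e3) ->
  is_basis S [:: e1; e2; e3].
Proof.
move=> free_e Se; split=> [c|u].
  rewrite !big_ord_recl big_ord0 /= addr0 addrA => /free_e[c0 c1 c2] i.
  case: i => -[|[|[|//]]] p; [rewrite -c0|rewrite -c1|rewrite -c2];
    by congr c; apply: val_inj.
rewrite Se; split=> [[a [b [c ->]]]|[c ->]].
  by exists (nth 0 [:: a; b; c]); rewrite !big_ord_recl big_ord0 /= addr0 addrA.
do 3 eexists; rewrite !big_ord_recl big_ord0 /= addr0 addrA; reflexivity.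
Qed.

End SmallBases.

(** * Identities on the span of a pair with [y x = x y + 1] *)

Section WeylPair.
Context (F : fieldType) (A : algType F) (x y : A).
Context (yx : y * x = x * y + 1).
Context (xy_free : forall p q : {poly F},
  horner_alg x p + horner_alg x q * y = 0 -> p = 0 /\ q = 0).

Local Notation X := (xgen F).
Local Notation e1 := (Gamma3 (X 0) (X 1) (X 2)).
Local Notation e2 := (Gamma3 (X 0) (X 2) (X 1)).
Local Notation e3 := (St3 (X 0) (X 1) (X 2)).

Lemma quadratic_free c d e :
  c *: 1 + d *: x + e *: (x * x) = 0 -> [/\ c = 0, d = 0 & e = 0].
Proof.
move=> cde; have [] := @xy_free (c%:P + d *: 'X + e *: ('X * 'X)) 0.
  rewrite rmorph0 mul0r addr0 !rmorphD /= !linearZ rmorphM /= horner_algC.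
  by rewrite !horner_algX !mulr_algl.
move=> /polyP p0 _; move: (p0 0%N) (p0 1%N) (p0 2%N).
by rewrite !coefE /= !(mulr0, mulr1, addr0, add0r).
Qed.

Lemma mixed_free a b : a *: (y * x) + b *: (x * y) = 0 -> a = 0 /\ b = 0.
Proof.
move=> ab; have [] := @xy_free a%:P ((a + b) *: 'X).
  rewrite horner_algC linearZ /= horner_algX ?mulr_algl -scalerAl.
  by rewrite -ab yx scalerDr scalerDl addrC addrAC.
by move=> /eqP; rewrite polyC_eq0 => /eqP-> /polyP/(_ 1%N);
  rewrite !coefE /= mulr1 add0r.
Qed.

(** The words with one [y] and two [x] span only [x^2 y] and [x]; [a + b + c] and
    [2 a + b] are the coordinates of the sum in these. *)
Lemma cubic_free a b c :
  a *: (y * (x * x)) + b *: (x * (y * x)) + c *: (x * (x * y)) = 0 ->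
  a + b + c = 0 /\ a *+ 2 + b = 0.
Proof.
have xyx : x * (y * x) = x * (x * y) + x by rewrite yx mulrDr mulr1.
have yxx : y * (x * x) = x * (x * y) + x *+ 2.
  by rewrite mulrA yx mulrDl mul1r -mulrA xyx mulr2n addrA.
move=> abc.
have [] := @xy_free ((a *+ 2 + b) *: 'X) ((a + b + c) *: ('X * 'X)).
  rewrite !linearZ rmorphM /= !horner_algX !mulr_algl -scalerAl -mulrA -abc xyx yxx.
  rewrite !scalerDr !scalerDl addrC addrAC.
  by congr (_ + _); rewrite addrACA.
move=> /polyP/(_ 1%N) + /polyP/(_ 2%N).
by rewrite !coefE /= !mulr1.
Qed.

(** For the generators of the Weyl algebra this is [weakId]. *)
Definition vanishes_on_span (f : freeAlg F nat) :=
  forall v : nat -> A, (forall i, exists a b : F, v i = a *: x + b *: y) ->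
  feval v f = 0.

Lemma vanishes_on_spanD f g :
  vanishes_on_span f -> vanishes_on_span g -> vanishes_on_span (f + g).
Proof. by move=> f0 g0 v Vv; rewrite fevalD f0 ?g0 ?addr0. Qed.

Lemma vanishes_on_spanZ c f : vanishes_on_span f -> vanishes_on_span (c *: f).
Proof. by move=> f0 v Vv; rewrite fevalZ f0 ?scaler0. Qed.

Lemma span0 : exists a b : F, 0 = a *: x + b *: y.
Proof. by exists 0, 0; rewrite !scale0r addr0. Qed.

Lemma span_x : exists a b : F, x = a *: x + b *: y.
Proof. by exists 1, 0; rewrite scale0r scale1r addr0. Qed.

Lemma span_y : exists a b : F, y = a *: x + b *: y.
Proof. by exists 0, 1; rewrite scale0r scale1r add0r. Qed.

Lemma lie_bracket_linear (u v w : A) a b :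
  lie_bracket (a *: u + b *: v) w = a *: lie_bracket u w + b *: lie_bracket v w.
Proof.
rewrite /lie_bracket mulrDl mulrDr opprD addrACA -!scalerAl -!scalerAr.
by rewrite !scalerBr.
Qed.

(** Commutators of elements of the plane are scalars: the determinant of the
    coordinates times [y x - x y = 1]. *)
Lemma span_bracket a b c d :
  lie_bracket (a *: x + b *: y) (c *: x + d *: y) = (b * c - a * d)%:A.
Proof.
have yx1 : lie_bracket y x = 1 by rewrite /lie_bracket yx addrC addKr.
have uu (u : A) : lie_bracket u u = 0 by rewrite /lie_bracket subrr.
rewrite lie_bracket_linear ![lie_bracket _ (c *: _ + _)]lie_bracketC.
rewrite !lie_bracket_linear [lie_bracket x y]lie_bracketC !uu yx1.
rewrite !scaler0 addr0 add0r !scalerN opprK !scalerA scalerBl.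
by rewrite addrC.
Qed.

Lemma Gamma3_span i j k : vanishes_on_span (Gamma3 (X i) (X j) (X k)).
Proof.
move=> v Vv; rewrite feval_Gamma3 3!feval_gen.
have [a [b vi]] := Vv i; have [c [d vj]] := Vv j.
rewrite /Gamma3 vi vj span_bracket /lie_bracket.
by rewrite mulr_algl mulr_algr subrr.
Qed.

Lemma St3_span i j k : vanishes_on_span (St3 (X i) (X j) (X k)).
Proof.
move=> v Vv.
rewrite feval_St3 3!feval_gen.
have [a [b vi]] := Vv i; have [c [d vj]] := Vv j; have [e [g vk]] := Vv k.
rewrite vi vj vk /St3 !span_bracket !mulr_algr.
(* The coefficients of [x] and of [y] are 3 x 3 determinants with a repeated
   column. *)
rewrite !scalerDr !scalerA opprD -!scaleNr [X in X + _]addrACA -!scalerDl.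
rewrite addrACA -!scalerDl.
by rewrite -[RHS]addr0; congr (_ + _); apply/eqP; rewrite scaler_eq0;
  apply/orP; left; apply/eqP; ring.
Qed.

(** Substituting [y] for letter [i] and [x] for the other two: the words group
    by the position of [i]. *)
Lemma multilinear_relations f i j k :
  vanishes_on_span f -> multideg [:: 1; 1; 1]%N f ->
  perm_eq [:: i; j; k] [:: 0; 1; 2]%N ->
  wcoef f [:: i; j; k] + wcoef f [:: i; k; j] +
    (wcoef f [:: j; i; k] + wcoef f [:: k; i; j]) +
    (wcoef f [:: j; k; i] + wcoef f [:: k; j; i]) = 0 /\
  (wcoef f [:: i; j; k] + wcoef f [:: i; k; j]) *+ 2 +
    (wcoef f [:: j; i; k] + wcoef f [:: k; i; j]) = 0.
Proof.
move=> f0 Df ijk; apply: cubic_free.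
pose v l := if l == i then y else x.
pose L := [:: [:: i; j; k]; [:: i; k; j]; [:: j; i; k]; [:: k; i; j];
              [:: j; k; i]; [:: k; j; i]].
have Ls : perm_eq L (permutations [:: 0; 1; 2]%N).
  have := ijk; have : all (fun l => l < 3)%N [:: i; j; k].
    by rewrite (perm_all _ ijk).
  by move: @L {v ijk}; case: i j k => [|[|[|i]]] [|[|[|j]]] [|[|[|k]]].
have [ji ki] : j != i /\ k != i.
  have : uniq [:: i; j; k] by rewrite (perm_uniq ijk).
  by rewrite /= !inE negb_or -!(eq_sym i) => /and3P[/andP[]].
have := f0 v; rewrite (feval_multideg count_111 v Ls Df) => <-.
  rewrite /L !big_cons !big_nil /v eqxx (negPf ji) (negPf ki) !mulr1 addr0.
  by rewrite !scalerDl -!addrA.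
by move=> l; rewrite /v; case: eqP => _; [apply: span_y | apply: span_x].
Qed.

Lemma multideg21_relations f :
  vanishes_on_span f -> multideg [:: 2; 1]%N f ->
  wcoef f [:: 1; 0; 0]%N + wcoef f [:: 0; 1; 0]%N + wcoef f [:: 0; 0; 1]%N = 0 /\
  wcoef f [:: 1; 0; 0]%N *+ 2 + wcoef f [:: 0; 1; 0]%N = 0.
Proof.
move=> f0 Df; apply: cubic_free.
pose v l := if l == 1%N then y else x.
have Ls : perm_eq [:: [:: 1; 0; 0]; [:: 0; 1; 0]; [:: 0; 0; 1]]%N
  (permutations [:: 0; 1; 0]%N) by [].
have := f0 v; rewrite (feval_multideg count_21 v Ls Df) => <-.
  by rewrite !big_cons !big_nil /v /= !mulr1 addr0 -!addrA.
by move=> l; rewrite /v; case: eqP => _; [apply: span_y | apply: span_x].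
Qed.

Lemma multideg3_vanishing f :
  vanishes_on_span f -> multideg [:: 3]%N f -> f = 0.
Proof.
move=> f0 Df.
have Ls : perm_eq [:: [:: 0; 0; 0]]%N (permutations [:: 0; 0; 0]%N) by [].
apply: (multideg_eq count_3 Df) => [|w]; first exact: multideg0.
rewrite -(perm_mem Ls) inE => /eqP->; rewrite wcoef0.
have := f0 (fun=> x); rewrite (feval_multideg count_3 _ Ls Df) => E.
have [|+ _] := @xy_free (wcoef f [:: 0; 0; 0]%N *: 'X^3) 0.
  rewrite rmorph0 mul0r addr0 linearZ /= rmorphXn /= horner_algX mulr_algl -E.
    by rewrite !big_cons !big_nil mulr1 addr0 !exprS expr0 mulr1.
  by move=> _; apply: span_x.
by move=> /polyP/(_ 3%N); rewrite !coefE eqxx mulr1.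
Qed.

Lemma low_degree_vanishing f :
  vanishes_on_span f -> (forall w, wcoef f w != 0 -> (size w <= 2)%N) ->
  f = 0.
Proof.
move=> f0 f2; apply: wcoef_inj => w; rewrite wcoef0; apply: contrapT => /eqP fw.
have sw := f2 w fw.
(* Substitute [x] for letter [i] and zero elsewhere. *)
have one_letter i : [/\ wcoef f [::] = 0, wcoef f [:: i] = 0 &
                        wcoef f [:: i; i] = 0].
  apply: quadratic_free; pose v j := if j == i then x else 0.
  have <- : feval v f = 0.
    by apply: f0 => j; rewrite /v; case: eqP => _; [apply: span_x|apply: span0].
  rewrite (@feval_supp _ _ v [:: [::]; [:: i]; [:: i; i]]).
  - by rewrite !big_cons !big_nil /v eqxx !mulr1 addr0 addrA.
  - by rewrite /= !inE !eqseq_cons !andbF.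
  move=> u uL /f2 su; have /allPn[j ju ji] : ~~ all (pred1 i) u.
    apply: contra uL => /all_pred1P ->.
    by case: (size u) su => [|[|[|]]] //; rewrite !inE eqxx ?orbT.
  by apply: (prod0 ju); rewrite /v ifN.
(* Substitute [y] for [i], [x] for [j]: besides the two mixed words, only words
   in a single letter survive, and those have coefficient zero by now. *)
have two_letters i j : i != j -> wcoef f [:: i; j] = 0.
  move=> ij; have ji : j != i by rewrite eq_sym.
  pose v l := if l == i then y else if l == j then x else 0.
  have := @mixed_free (wcoef f [:: i; j]) (wcoef f [:: j; i]).
  case=> //; have <- : feval v f = 0.
    apply: f0 => l; rewrite /v; case: eqP => _; first exact: span_y.
    by case: eqP => _; [apply: span_x|apply: span0].
  have [c0 ci cii] := one_letter i; have [_ cj cjj] := one_letter j.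
  rewrite (@feval_supp _ _ v [:: [:: i; j]; [:: j; i]]).
  - by rewrite !big_cons !big_nil /v !eqxx (negPf ji) !mulr1 addr0.
  - by rewrite /= inE eqseq_cons (negPf ij).
  move=> u uL fu; have /allPn[l lu] : ~~ all (fun l => (l == i) || (l == j)) u.
    apply: contra uL; move: fu (f2 u fu).
    case: u => [|k [|l [|]]] //=; rewrite ?c0 ?eqxx //.
      by move=> + _; rewrite andbT => + /orP[] /eqP kE; rewrite kE ?ci ?cj eqxx.
    move=> + _; rewrite andbT !inE => + /andP[/orP[] /eqP kE /orP[] /eqP lE];
      by rewrite kE lE ?cii ?cjj ?eqxx ?orbT.
  rewrite negb_or => /andP[li lj].
  by apply: (prod0 lu); rewrite /v (negPf li) (negPf lj).
case: w fw sw => [|i [|j [|]]] // fw _; move/eqP: fw; apply.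
- by have [] := one_letter 0%N.
- by have [] := one_letter i.
have [<-|/two_letters//] := eqVneq i j.
by have [] := one_letter i.
Qed.

Local Notation Id D :=
  [set f : freeAlg F nat | vanishes_on_span f /\ multideg D f]%classic.

Lemma Gamma3_neq0 : Gamma3 (X 0) (X 1) (X 0) <> 0.
Proof.
move=> /(congr1 (fun f => wcoef f [:: 0; 0; 1]%N)).
rewrite wcoef_Gamma3 wcoef0 /= => /eqP.
by rewrite !subr0 sub0r oppr_eq0 oner_eq0.
Qed.

Lemma wcoef_comb111 a b c w (d := fun s => (s == w)%:R : F) :
  wcoef (a *: e1 + b *: e2 + c *: e3) w =
    a * (d [:: 0; 1; 2]%N - d [:: 2; 0; 1]%N - (d [:: 1; 0; 2]%N - d [:: 2; 1; 0]%N)) +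
    b * (d [:: 0; 2; 1]%N - d [:: 1; 0; 2]%N - (d [:: 2; 0; 1]%N - d [:: 1; 2; 0]%N)) +
    c * (d [:: 0; 1; 2]%N - d [:: 0; 2; 1]%N - (d [:: 1; 0; 2]%N - d [:: 1; 2; 0]%N) +
         (d [:: 2; 0; 1]%N - d [:: 2; 1; 0]%N)).
Proof.
have comb (p q r : freeAlg F nat) p' q' r' :
    wcoef p w = p' -> wcoef q w = q' -> wcoef r w = r' ->
    wcoef (a *: p + b *: q + c *: r) w = a * p' + b * q' + c * r'.
  move=> <- <- <-; rewrite (wcoefD (a *: p + b *: q)) (wcoefD (a *: p)).
  by congr (_ + _ + _); apply: wcoefZ.
by apply: comb; [apply: wcoef_Gamma3|apply: wcoef_Gamma3|apply: wcoef_St3].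
Qed.

Lemma multilinear_basis : is_basis (Id [:: 1; 1; 1]%N) [:: e1; e2; e3].
Proof.
have De a b c : multideg [:: 1; 1; 1]%N (a *: e1 + b *: e2 + c *: e3).
  by apply: multidegD; [apply: multidegD|]; apply: multidegZ;
    [apply: multideg_Gamma3; exact: count_111|
     apply: multideg_Gamma3; by case=> [|[|[|l]]] //=; rewrite nth_nil|
     apply: multideg_St3; exact: count_111].
apply: is_basis3 => [a b c e0|f].
  have E w := etrans (congr1 (fun f => wcoef f w) (esym e0))
                     (wcoef_comb111 a b c w).
  move: (E [:: 0; 1; 2]%N) (E [:: 1; 0; 2]%N) (E [:: 1; 2; 0]%N).
  rewrite /= !wcoef0 => /esym E012 /esym E102 /esym E120.
  have ac : a + c = 0 by rewrite -[RHS]E012; ring.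
  have abc : a + b + c = 0.
    by apply: oppr_inj; rewrite oppr0 -[RHS]E102; ring.
  have b0 : b = 0 by move: abc; rewrite addrAC ac add0r.
  have c0 : c = 0 by rewrite -[RHS]E120 b0; ring.
  by split=> //; rewrite -ac c0 addr0.
split=> [[f0 Df]|[a [b [c ->]]]]; last first.
  split; last exact: De.
  by apply: vanishes_on_spanD; [apply: vanishes_on_spanD|];
    apply: vanishes_on_spanZ;
    [apply: Gamma3_span|apply: Gamma3_span|apply: St3_span].
have [S R0] := @multilinear_relations f 0 1 2 f0 Df isT.
have [_ R1] := @multilinear_relations f 1 0 2 f0 Df isT.
set a012 := wcoef f [:: 0; 1; 2]%N in S R0 R1.
set a021 := wcoef f [:: 0; 2; 1]%N in S R0 R1.
set a102 := wcoef f [:: 1; 0; 2]%N in S R0 R1.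
set a120 := wcoef f [:: 1; 2; 0]%N in S R0 R1.
set a201 := wcoef f [:: 2; 0; 1]%N in S R0 R1.
set a210 := wcoef f [:: 2; 1; 0]%N in S R0 R1.
(* The relations leave [a012], [a102] and [a120] free; a zero on one side is
   replaced by the left-hand side of a relation for [ring] to conclude. *)
have E210 : a210 = - (a102 + a120) *+ 2 - a012 by rewrite -[LHS]subr0 -R1; ring.
have E021 : a021 = a120 + a210 - a012.
  by rewrite -[RHS]subr0 -S -[RHS]addr0 -R0; ring.
have E201 : a201 = - (a012 + a021) *+ 2 - a102 by rewrite -[LHS]subr0 -R0; ring.
(* The values [c1 + c3], [- (c1 + c2 + c3)] and [c2 + c3] of the free coefficients
   determine [c1], [c2] and [c3]. *)
pose c1 := - a120 - a102; pose c2 := - a102 - a012.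
pose c3 := a120 + a102 + a012; exists c1, c2, c3.
apply: (multideg_eq count_111 Df (De c1 c2 c3)) => w.
have Ls : perm_eq [:: [:: 0; 1; 2]; [:: 0; 2; 1]; [:: 1; 0; 2]; [:: 1; 2; 0];
                     [:: 2; 0; 1]; [:: 2; 1; 0]]%N (permutations [:: 0; 1; 2]%N).
  by [].
rewrite wcoef_comb111 -(perm_mem Ls) {Ls} !inE => /or4P[|||/or3P[]] /eqP->;
  rewrite /= -/a012 -/a021 -/a102 -/a120 -/a201 -/a210;
  rewrite /c1 /c2 /c3 ?E201 ?E021 ?E210; ring.
Qed.

Lemma multideg21_basis : is_basis (Id [:: 2; 1]%N) [:: Gamma3 (X 0) (X 1) (X 0)].
Proof.
have De a : multideg [:: 2; 1]%N (a *: Gamma3 (X 0) (X 1) (X 0)).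
  by apply: multidegZ; apply: multideg_Gamma3; exact: count_21.
apply: is_basis1 => [|f]; first by apply/eqP; exact: Gamma3_neq0.
split=> [[f0 Df]|[a ->]]; last first.
  by split; [apply: vanishes_on_spanZ; apply: Gamma3_span | apply: De].
have [S R] := multideg21_relations f0 Df.
exists (- wcoef f [:: 1; 0; 0]%N); apply: (multideg_eq count_21 Df (De _)) => w.
have Ls : perm_eq [:: [:: 1; 0; 0]; [:: 0; 1; 0]; [:: 0; 0; 1]]%N
                  (permutations [:: 0; 1; 0]%N) by [].
rewrite wcoefZ wcoef_Gamma3 -(perm_mem Ls) {Ls} !inE.
set a := wcoef f [:: 1; 0; 0]%N in S R *.
have E010 : wcoef f [:: 0; 1; 0]%N = - a *+ 2 by rewrite -[LHS]subr0 -R; ring.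
have E001 : wcoef f [:: 0; 0; 1]%N = a.
  by rewrite -[LHS]subr0 -S E010; ring.
by move=> /or3P[] /eqP->; rewrite /= -?/a ?E010 ?E001; ring.
Qed.

Lemma multideg3_basis : is_basis (Id [:: 3]%N) [::].
Proof.
apply: is_basis0 => f; split=> [[f0 Df]|->].
  exact: (multideg3_vanishing f0 Df).
by split=> [v _|]; [exact: mmap0 | exact: multideg0].
Qed.

Lemma weak_identity_degree_ge3 f :
  vanishes_on_span f -> f <> 0 -> (3 <= fdegree f)%N.
Proof.
move=> f0 fn0; rewrite leqNgt; apply/negP => f3; apply: fn0.
apply: (low_degree_vanishing f0) => w fw; rewrite -ltnS.
apply: leq_ltn_trans f3; apply: (leq_bigmax_seq (FMonom w)) => //.
by rewrite -mcoeff_neq0.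
Qed.

End WeylPair.

(** * Normal forms in the Weyl algebra *)

Section WeylNormalForm.
Context (F : fieldType).
Implicit Types (a b : weyl F) (p q r : {poly F}).

(** The operator on [F[t]] given by an element of the Weyl algebra, through the
    choice of a representative; [weyl_op_pi] shows the choice to be immaterial. *)
Definition weyl_op a r : {poly F} := weyl_act r (weyl_repr a).

Lemma weyl_act_ideal r (f : freeAlg F bool) :
  f \in @weyl_ideal F -> weyl_act r f = 0.
Proof.
move=> /weyl_idealP[s ->]; rewrite /weyl_act raddf_sum /= big1 // => p _.
by rewrite -/(weyl_act _ _) !weyl_actM weyl_act_rel weyl_act0.
Qed.

Lemma weyl_op_pi f r : weyl_op (weyl_pi f) r = weyl_act r f.
Proof.
apply/eqP; rewrite -subr_eq0 -[weyl_op _ _]/(weyl_act _ _).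
rewrite -[X in X == 0](raddfB (mmap polyC (fun w => word_act w r))).
by rewrite [_ == 0](introT eqP (weyl_act_ideal r (weyl_piK f))).
Qed.

Lemma weyl_op0 r : weyl_op 0 r = 0.
Proof. by rewrite -(raddf0 (@weyl_pi F)) weyl_op_pi /weyl_act mmap0. Qed.

Lemma weyl_opD a b r : weyl_op (a + b) r = weyl_op a r + weyl_op b r.
Proof.
elim/weyl_ind: a => f; elim/weyl_ind: b => g.
by rewrite -raddfD !weyl_op_pi /weyl_act mmapD.
Qed.

Lemma weyl_opM a b r : weyl_op (a * b) r = weyl_op a (weyl_op b r).
Proof.
elim/weyl_ind: a => f; elim/weyl_ind: b => g.
by rewrite [_ * _]weyl_mulE !weyl_op_pi weyl_actM.
Qed.

Lemma weyl_opZ c a r : weyl_op (c *: a) r = c *: weyl_op a r.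
Proof.
elim/weyl_ind: a => f; rewrite [_ *: _]weyl_scaleE !weyl_op_pi.
by rewrite -mul_malgC weyl_actM /weyl_act mmapU /= /word_act fm1 mul_polyC.
Qed.

Lemma weyl_op1 r : weyl_op 1 r = r.
Proof. by rewrite [1]/(weyl_pi 1) weyl_op_pi weyl_act1. Qed.

Lemma weyl_op_x r : weyl_op weyl_x r = 'X * r.
Proof. by rewrite weyl_op_pi weyl_act_gen. Qed.

Lemma weyl_op_y r : weyl_op weyl_y r = r^`().
Proof. by rewrite weyl_op_pi weyl_act_gen. Qed.

Lemma weyl_op_horner p r : weyl_op (horner_alg weyl_x p) r = p * r.
Proof.
elim/poly_ind: p r => [|p c IHp] r; first by rewrite rmorph0 weyl_op0 mul0r.
rewrite rmorphD rmorphM /= horner_algX horner_algC weyl_opD weyl_opM.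
by rewrite weyl_opZ weyl_op1 weyl_op_x IHp -mul_polyC mulrDl -mulrA.
Qed.

(** Apply the operator to [1], whose derivative vanishes, then to [t]. *)
Lemma weyl_free p q :
  horner_alg weyl_x p + horner_alg weyl_x q * weyl_y = 0 :> weyl F ->
  p = 0 /\ q = 0.
Proof.
move=> pq; have E r : p * r + q * r^`() = 0.
  by rewrite -(weyl_op0 r) -pq weyl_opD weyl_opM weyl_op_y !weyl_op_horner.
have p0 : p = 0 by have := E 1; rewrite mulr1 derivC mulr0 addr0.
by split=> //; have := E 'X; rewrite p0 mul0r add0r derivX mulr1.
Qed.

Lemma weyl_yx : weyl_y * weyl_x = weyl_x * weyl_y + 1 :> weyl F.
Proof. by rewrite -[X in _ + X](weyl_relE F) addrC subrK. Qed.

End WeylNormalForm.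

Theorem theorem6p3 (F : fieldType) (Finf : infinite_set [set: F]%classic) :
  ((exists f : freeAlg F nat, [/\ weakId f, f <> 0 & fdegree f = 3%N]) /\
   (forall f : freeAlg F nat, weakId f -> f <> 0 -> (3 <= fdegree f)%N)) /\
  [/\ is_basis (weakId_multideg (F := F) [:: 1; 1; 1]%N)
        [:: Gamma3 (xgen F 0) (xgen F 1) (xgen F 2);
            Gamma3 (xgen F 0) (xgen F 2) (xgen F 1);
            St3 (xgen F 0) (xgen F 1) (xgen F 2)],
      is_basis (weakId_multideg (F := F) [:: 2; 1]%N)
        [:: Gamma3 (xgen F 0) (xgen F 1) (xgen F 0)]
    & is_basis (weakId_multideg (F := F) [:: 3]%N) [::]].
Proof.
have yx := weyl_yx F; have free := @weyl_free F.
split; [split|split].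
- exists (Gamma3 (xgen F 0) (xgen F 1) (xgen F 0)); split.
  + exact: (Gamma3_span yx).
  + exact: Gamma3_neq0.
  + apply: (fdegree_multideg count_21); last exact: Gamma3_neq0.
    by apply: multideg_Gamma3; exact: count_21.
- exact: weak_identity_degree_ge3 yx free.
- exact: multilinear_basis yx free.
- exact: multideg21_basis yx free.
- exact: multideg3_basis free.
Qed.
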